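(* Let $\psi(y_1,\dots,y_n,x)$ be a quantifier-free formula in the (continuous-logic) language of bi-invariant metric groups and let $\varphi$ be the sentence $\inf_x\sup_{y_1,\dots,y_n}\psi(y_1,\dots,y_n,x)$. Then the sequence $(\varphi^{U_n})_{n\in\mathbb{N}}$ converges.
   Context: $U_n$ is the group of $n\times n$ complex unitary matrices, regarded as a bi-invariant metric group (metric structure with multiplication, inverse, identity and metric) with metric $d(A,B)=\frac{\|A-B\|_2}{2\sqrt n}$, where $\|\cdot\|_2$ is the Hilbert–Schmidt norm. $\varphi^{U_n}$ is the value of $\varphi$ in $U_n$ in continuous logic. *)

(* Defs.v *)
From HB Require Import structures.
From mathcomp Require Import all_boot all_order all_algebra.
From mathcomp Require Import sesquilinear spectral.
From mathcomp Require Import all_classical all_reals all_analysis.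
From mathcomp Require Import complex.

Set Implicit Arguments.
Unset Strict Implicit.
Unset Printing Implicit Defensive.

Import Order.TTheory GRing.Theory Num.Theory.
Import numFieldNormedType.Exports.

Local Open Scope classical_set_scope.
Local Open Scope ring_scope.
Local Open Scope sesquilinear_scope.

(* The diameter bound is the usual continuous-logic convention that the metric
   is a [0,1]-valued predicate. *)
HB.mixin Record isBiInvariant (R : numFieldType) G
    of Group G & Metric R G := {
  mdist_mull : forall a x y : G, mdist (a * x)%g (a * y)%g = mdist x y ;
  mdist_mulr : forall a x y : G, mdist (x * a)%g (y * a)%g = mdist x y ;
  mdist_le1 : forall x y : G, mdist x y <= 1
}.

#[short(type="biMetricGroupType")]
HB.structure Definition BiMetricGroup (R : numFieldType) :=
  { G of Group G & Metric R G & isBiInvariant R G }.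

Inductive term : Type :=
  | Var of nat
  | One
  | Mul of term & term
  | Inv of term.

Section Formulas.
Variable R : realType.

Definition cube k : set 'rV[R]_k := [set v | forall i, 0 <= v 0 i <= 1].

(* Only the restriction of a connective to the cube is meaningful. *)
Record connective (k : nat) := Connective {
  conn_fun :> 'rV[R]_k -> R ;
  conn_continuous : {within @cube k, continuous conn_fun} ;
  conn_itv : forall v, cube v -> 0 <= conn_fun v <= 1
}.

Inductive formula : Type :=
  | Dist of term & term
  | Conn k of connective k & ('I_k -> formula)
  | Sup of nat & formula
  | Inf of nat & formula.

Fixpoint quantifier_free (f : formula) : Prop :=
  match f with
  | Dist _ _ => True
  | Conn _ _ fs => forall i, quantifier_free (fs i)
  | Sup _ _ | Inf _ _ => False
  end.

Fixpoint occurs (z : nat) (t : term) : Prop :=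
  match t with
  | Var x => z = x
  | One => False
  | Mul s t => occurs z s \/ occurs z t
  | Inv t => occurs z t
  end.

Fixpoint free_in (z : nat) (f : formula) : Prop :=
  match f with
  | Dist s t => occurs z s \/ occurs z t
  | Conn _ _ fs => exists i, free_in z (fs i)
  | Sup x f | Inf x f => z <> x /\ free_in z f
  end.

Section Semantics.
Variable G : biMetricGroupType R.

Definition upd (rho : nat -> G) (x : nat) (a : G) : nat -> G :=
  fun z => if z == x then a else rho z.

Fixpoint teval (rho : nat -> G) (t : term) : G :=
  match t with
  | Var x => rho x
  | One => 1%g
  | Mul s t => (teval rho s * teval rho t)%g
  | Inv t => ((teval rho t)^-1)%g
  end.

Fixpoint feval (f : formula) (rho : nat -> G) : R :=
  match f with
  | Dist s t => mdist (teval rho s) (teval rho t)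
  | Conn _ u fs => u (\row_i feval (fs i) rho)
  | Sup x f => sup (range (fun a : G => feval f (upd rho x a)))
  | Inf x f => inf (range (fun a : G => feval f (upd rho x a)))
  end.

Lemma feval_itv f rho : 0 <= feval f rho <= 1.
Proof.
elim: f rho => [s t|k u fs IH|x f IH|x f IH] rho /=.
- by rewrite mdist_ge0 mdist_le1.
- by apply: conn_itv => i; rewrite mxE.
- set A := (X in sup X); have A1 : A (feval f (upd rho x 1%g)) by exists 1%g.
  have ubA : ubound A 1 by move=> _ [a _ <-]; case/andP: (IH (upd rho x a)).
  apply/andP; split; last by apply: ge_sup => //; eexists; exact: A1.
  have /andP[f_ge0 _] := IH (upd rho x 1%g); apply: le_trans f_ge0 _.
  by apply: ub_le_sup A1; exists 1.
- set A := (X in inf X); have A1 : A (feval f (upd rho x 1%g)) by exists 1%g.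
  have lbA : lbound A 0 by move=> _ [a _ <-]; case/andP: (IH (upd rho x a)).
  apply/andP; split; first by apply: lb_le_inf => //; eexists; exact: A1.
  have /andP[_ f_le1] := IH (upd rho x 1%g); apply: le_trans f_le1.
  by apply: ge_inf A1; exists 0.
Qed.

Lemma eq_teval t rho rho' :
  (forall z, occurs z t -> rho z = rho' z) -> teval rho t = teval rho' t.
Proof.
elim: t => [x|//|s IHs t IHt|t IH] /= e; first exact: e.
- by rewrite IHs ?IHt // => z h; apply: e; [right|left].
- by rewrite IH.
Qed.

Lemma eq_feval f rho rho' :
  (forall z, free_in z f -> rho z = rho' z) -> feval f rho = feval f rho'.
Proof.
elim: f rho rho' => [s t|k u fs IH|x f IH|x f IH] rho rho' /= e.
- rewrite (@eq_teval s rho rho'); last by move=> z h; apply: e; left.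
  by rewrite (@eq_teval t rho rho') // => z h; apply: e; right.
- congr (u _); apply/rowP => i; rewrite !mxE.
  by apply: IH => z h; apply: e; exists i.
- congr sup; apply: eq_imagel => a _; apply: IH => z h.
  by rewrite /upd; case: eqP => // zx; apply: e.
- congr inf; apply: eq_imagel => a _; apply: IH => z h.
  by rewrite /upd; case: eqP => // zx; apply: e.
Qed.

(* The valuation is immaterial on sentences, by eq_feval. *)
Definition sentence_value (f : formula) : R := feval f (fun=> 1%g).

End Semantics.

End Formulas.

Section UnitaryGroup.
Variables (R : realType) (n : nat).

Definition hsnorm (A : 'M[R[i]]_n) : R :=
  Num.sqrt (\sum_i \sum_j Normc.normc (A i j) ^+ 2).

Record unitary := Unitary {
  unitary_mx :> 'M[R[i]]_n ;
  unitary_mxP : unitary_mx \is unitarymx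
}.

HB.instance Definition _ := [isSub for unitary_mx].
HB.instance Definition _ := [Choice of unitary by <:].

Lemma unitary_mx1 : (1%:M : 'M[R[i]]_n) \is unitarymx.
Proof. by apply/unitarymxP; rewrite trmx1 map_mx1 mulmx1. Qed.

Lemma unitary_mxV (A : unitary) : (unitary_mx A) ^t* \is unitarymx.
Proof. by rewrite trmxC_unitary unitary_mxP. Qed.

Definition unitary_one := Unitary unitary_mx1.
Definition unitary_inv (A : unitary) := Unitary (unitary_mxV A).
Definition unitary_mul (A B : unitary) :=
  Unitary (mul_unitarymx (unitary_mxP A) (unitary_mxP B)).

Lemma unitary_mulA : associative unitary_mul.
Proof. by move=> A B C; apply: val_inj; rewrite /= mulmxA. Qed.

Lemma unitary_mul1 : left_id unitary_one unitary_mul.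
Proof. by move=> A; apply: val_inj; rewrite /= mul1mx. Qed.

Lemma unitary_mulr1 : right_id unitary_one unitary_mul.
Proof. by move=> A; apply: val_inj; rewrite /= mulmx1. Qed.

Lemma unitary_mulrV : right_inverse unitary_one unitary_inv unitary_mul.
Proof. by move=> A; apply: val_inj; apply/unitarymxP/unitary_mxP. Qed.

Lemma unitary_mulV : left_inverse unitary_one unitary_inv unitary_mul.
Proof. by move=> A; apply: val_inj; apply/mulmx1C/unitarymxP/unitary_mxP. Qed.

HB.instance Definition _ := isGroup.Build unitary
  unitary_mulA unitary_mul1 unitary_mulr1 unitary_mulV unitary_mulrV.

Lemma hsnorm_ge0 A : 0 <= hsnorm A.
Proof. exact: sqrtr_ge0. Qed.

Lemma hsnorm_sqr A : (hsnorm A ^+ 2)%:C%C = \tr (A *m A ^t*).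
Proof.
rewrite /hsnorm sqr_sqrtr; last first.
  by apply: sumr_ge0 => i _; apply: sumr_ge0 => j _; apply: sqr_ge0.
rewrite rmorph_sum; apply: eq_bigr => i _; rewrite rmorph_sum mxE.
apply: eq_bigr => j _; rewrite !mxE rmorphXn -normCK.
by [].
Qed.

Lemma hsnorm_dotmx A : (hsnorm A)%:C%C = sqrtC (dotmx (mxvec A) (mxvec A)).
Proof.
have -> : dotmx (mxvec A) (mxvec A) = (hsnorm A)%:C%C ^+ 2.
  rewrite -rmorphXn /= hsnorm_sqr dotmxE mxE.
  rewrite (reindex _ (curry_mxvec_bij _ _)) /= /mxtrace.
  under [RHS]eq_bigr do rewrite mxE.
  rewrite pair_bigA; apply: eq_bigr => -[i j] _ /=.
  by rewrite !mxE !mxvecE.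
by rewrite sqrCK // lecR hsnorm_ge0.
Qed.

Lemma hsnorm0_eq0 A : hsnorm A = 0 -> A = 0.
Proof.
move=> A0; have := hsnorm_dotmx A; rewrite A0 => /esym/eqP.
by rewrite sqrt_dnorm_eq0 mxvec_eq0 => /eqP.
Qed.

Lemma hsnormD A B : hsnorm (A + B) <= hsnorm A + hsnorm B.
Proof.
rewrite -lecR rmorphD /= !hsnorm_dotmx linearD.
exact: triangle_lerif.
Qed.

Lemma hsnorm_inj_sqr A B : \tr (A *m A ^t*) = \tr (B *m B ^t*) -> hsnorm A = hsnorm B.
Proof.
rewrite -!hsnorm_sqr => -[] /eqP.
by rewrite eqrXn2 ?hsnorm_ge0 // => /eqP.
Qed.

Lemma hsnormN A : hsnorm (- A) = hsnorm A.
Proof.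
apply: hsnorm_inj_sqr; congr (\tr _).
by apply/matrixP => i j; rewrite !mxE; apply: eq_bigr => k _; rewrite !mxE rmorphN mulrNN.
Qed.

Lemma hsnorm_mull (U : unitary) A : hsnorm (U *m A) = hsnorm A.
Proof.
apply: hsnorm_inj_sqr; rewrite trmx_mul map_mxM mulmxA mxtrace_mulC !mulmxA.
have /unitarymxP/mulmx1C -> := unitary_mxP U.
by rewrite mul1mx.
Qed.

Lemma hsnorm_mulr (U : unitary) A : hsnorm (A *m U) = hsnorm A.
Proof.
apply: hsnorm_inj_sqr; rewrite trmx_mul map_mxM !mulmxA.
by rewrite mulmxtVK ?unitary_mxP.
Qed.

Lemma hsnorm_unitary (U : unitary) : hsnorm U = Num.sqrt n%:R.
Proof.
have : hsnorm U ^+ 2 = n%:R.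
  have := hsnorm_sqr U; have /unitarymxP -> := unitary_mxP U.
  by rewrite mxtrace1 -(rmorph_nat (real_complex R)) => -[].
by move=> <-; rewrite sqrtr_sqr ger0_norm ?hsnorm_ge0.
Qed.

Definition unitary_dist (A B : unitary) : R :=
  hsnorm (unitary_mx A - unitary_mx B) / (2 * Num.sqrt n%:R).

Lemma unitary_dist_scale_ge0 : 0 <= (2 * Num.sqrt n%:R : R)^-1.
Proof. by rewrite invr_ge0 mulr_ge0 ?sqrtr_ge0. Qed.

Lemma unitary_distxx A : unitary_dist A A = 0.
Proof.
rewrite /unitary_dist subrr /hsnorm big1 ?sqrtr0 ?mul0r // => i _.
by rewrite big1 // => j _; rewrite mxE Normc.normc0 expr0n.
Qed.

Lemma unitary_dist_eq0 A B : unitary_dist A B = 0 -> A = B.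
Proof.
move=> /eqP; rewrite mulf_eq0 invr_eq0 mulf_eq0 pnatr_eq0 /= => /orP[/eqP|].
  by move/hsnorm0_eq0/eqP; rewrite subr_eq0 => /eqP/val_inj.
rewrite sqrtr_eq0 lern0 => /eqP n0; apply/val_inj/matrixP => i.
by move: (ltn_ord i); rewrite [X in (_ < X)%N]n0.
Qed.

Lemma unitary_dist_sym A B : unitary_dist A B = unitary_dist B A.
Proof. by rewrite /unitary_dist -hsnormN opprB. Qed.

Lemma unitary_dist_triangle B A C :
  unitary_dist A C <= unitary_dist A B + unitary_dist B C.
Proof.
rewrite /unitary_dist -mulrDl ler_wpM2r ?unitary_dist_scale_ge0 //.
by apply: le_trans (hsnormD _ _); rewrite addrA subrK.
Qed.

HB.instance Definition _ := @isMetric.Build R unitary unitary_dist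
  unitary_distxx unitary_dist_eq0 unitary_dist_sym unitary_dist_triangle.

Lemma unitary_dist_mull (U A B : unitary) :
  mdist (U * A)%g (U * B)%g = mdist A B :> R.
Proof.
change (unitary_dist (unitary_mul U A) (unitary_mul U B) = unitary_dist A B).
by rewrite /unitary_dist /= -mulmxBr hsnorm_mull.
Qed.

Lemma unitary_dist_mulr (U A B : unitary) :
  mdist (A * U)%g (B * U)%g = mdist A B :> R.
Proof.
change (unitary_dist (unitary_mul A U) (unitary_mul B U) = unitary_dist A B).
by rewrite /unitary_dist /= -mulmxBl hsnorm_mulr.
Qed.

Lemma unitary_dist_le1 (A B : unitary) : mdist A B <= 1 :> R.
Proof.
change (unitary_dist A B <= 1); rewrite /unitary_dist.
have le2 : hsnorm (unitary_mx A - unitary_mx B) <= 2 * Num.sqrt n%:R.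
  by rewrite (le_trans (hsnormD _ _)) // hsnormN !hsnorm_unitary mulr2n mulrDl mul1r.
have := sqrtr_ge0 (n%:R : R); rewrite le_eqVlt => /predU1P[n0|n_gt0].
  by rewrite -n0 mulr0 invr0 mulr0.
by rewrite ler_pdivrMr ?mulr_gt0 // mul1r.
Qed.

HB.instance Definition _ := isBiInvariant.Build R unitary
  unitary_dist_mull unitary_dist_mulr unitary_dist_le1.

End UnitaryGroup.

(* Main.v *)
(* Write [v N] for the value of the sentence in the unitary group of rank [N].
   Since there is only one outer variable, a single unitary matrix [X] of rank
   [m = n * k + r] has to be understood, and up to conjugation it is its list of
   eigenvalues. Sort that list along a partition of the circle into small boxes,
   and cut it into [n] blocks of length [k] and a remainder of length [r < n]:
   for [n] large and [m] large compared with [n], [X] is close to a conjugate of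
   [h A], where [h A] is the direct sum of [k] copies of [A] and of an identity
   matrix, and [A] is the diagonal matrix of the first eigenvalues of the blocks.
   The map [h] is a group homomorphism that almost preserves distances, so the
   inner suprema can only grow along it, up to an error. Hence
   [v n <= v m + e] for all large [n] and all [m] large compared with [n], and a
   bounded sequence with this property converges. *)
Require Import Defs.
From mathcomp Require Import all_boot all_order all_algebra all_fingroup.
From mathcomp Require Import all_classical all_reals all_analysis.
From mathcomp Require Import sesquilinear spectral complex mxtens.
From mathcomp Require Import lra ring zify.

Set Implicit Arguments.
Unset Strict Implicit.
Unset Printing Implicit Defensive.

Import Order.TTheory GRing.Theory Num.Theory.
Import numFieldNormedType.Exports.
Local Open Scope classical_set_scope.
Local Open Scope ring_scope.
Local Open Scope sesquilinear_scope.

(** * Uniform continuity of connectives *)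

(** Heine-Cantor for a function continuous only relative to [K]: the near-covering form of
    compactness turns the local radii into one radius. *)
Lemma compact_within_unif_continuous (R : realType) (T : pseudoMetricType R)
    (K : set T) (f : T -> R) :
  compact K -> {within K, continuous f} ->
  forall e : R, 0 < e -> exists2 d : R, 0 < d &
    forall v w, K v -> K w -> ball v d w -> `|f v - f w| <= e.
Proof.
move=> /compact_near_coveringP/near_covering_withinP cK.
move=> /subspace_continuousP; rewrite /from_subspace => cf e e0.
pose P (d : R) v := forall w, K w -> ball v d w -> `|f v - f w| <= e.
have : \forall d \near 0^'+, K `<=` P d.
  apply: cK => v Kv; have e20 : 0 < e / 2 by rewrite divr_gt0.
  have /cvgrPdist_le /(_ _ e20) := cf v Kv.
  rewrite near_withinE => /nbhs_ballP[d /= d0 vd].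
  (* With both radii halved, [v'] and [w] lie in [ball v d], so [f] at each of them is within
     [e / 2] of [f v]. *)
  exists (ball v (d / 2), [set i | i < d / 2]) => /=.
    split; first by apply: nbhsx_ballx; rewrite divr_gt0.
    by apply: nbhs_right_lt; rewrite divr_gt0.
  move=> [v' i] /= [vv' id] Kv' w Kw v'w.
  have vw : ball v d w.
    by rewrite (splitr d); apply: ball_triangle vv' (le_ball (ltW id) v'w).
  have v'd : ball v d v' by apply: le_ball vv'; lra.
  have := vd _ v'd Kv'; have := vd _ vw Kw.
  rewrite !ler_norml => /andP[? ?] /andP[? ?]; apply/andP; split; lra.
move=> PK.
have [d [d0 Kd]] : exists d : R, 0 < d /\ K `<=` P d.
  near (0 : R)^'+ => d; exists d; split; near: d => //.
  exact: nbhs_right_gt.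
by exists d => // v w Kv; apply: Kd.
Unshelve. all: by end_near. Qed.

Lemma compact_cube (R : realType) k : compact (@cube R k).
Proof.
rewrite (_ : @cube R k = [set v : 'rV[R]_k | forall i, `[0, 1]%classic (v ord0 i)]).
  by apply: (@rV_compact R k (fun=> `[0, 1]%classic)) => _; exact: segment_compact.
by apply/seteqP; split => v /= h i; have := h i; rewrite in_itv.
Qed.

Lemma connective_unif_continuous (R : realType) k (u : connective R k) (e : R) :
  0 < e -> exists2 d, 0 < d & forall v w : 'rV[R]_k, cube v -> cube w ->
    (forall i, `|v 0 i - w 0 i| <= d) -> `|u v - u w| <= e.
Proof.
move=> e0; have [d d0 ud] := compact_within_unif_continuous
  (@compact_cube R k) (@conn_continuous R k u) e0.
exists (d / 2); first by rewrite divr_gt0.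
move=> v w cv cw vw; apply: ud => //; split=> // i j; rewrite ord1.
rewrite /ball /=; apply: le_lt_trans (vw j) _; lra.
Qed.

(** * Formulas along almost isometric homomorphisms *)

Section ApproximateEmbeddings.
Variable R : realType.
Implicit Types G H : biMetricGroupType R.

(** The group structure is preserved exactly and only the metric is distorted, so [h] commutes with
    the evaluation of terms. *)
Definition almost_isometry G H (d : R) (h : G -> H) :=
  [/\ h 1%g = 1%g, forall a b, h (a * b)%g = (h a * h b)%g &
      forall a b, `|mdist (h a) (h b) - mdist a b| <= d].

Lemma mdist_mul G (a a' b b' : G) :
  mdist (a * b)%g (a' * b')%g <= mdist a a' + mdist b b' :> R.
Proof.
apply: le_trans (metric_triangle _ (a' * b)%g _) _.
by rewrite mdist_mulr mdist_mull.
Qed.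

Lemma mdist_inv G (a b : G) : mdist a^-1%g b^-1%g = mdist a b :> R.
Proof.
rewrite -(mdist_mull a) -(mdist_mulr b) mulgV mul1g mulgVK.
exact: metric_sym.
Qed.

(** Counts the occurrences of variables. By bi-invariance, this is a Lipschitz constant of the term
    as a function of its valuation, for the uniform distance. *)
Fixpoint tsize (t : term) : nat :=
  match t with
  | Var _ => 1
  | Defs.One => 0
  | Defs.Mul s t => tsize s + tsize t
  | Defs.Inv t => tsize t
  end.

Lemma teval_almost_isometry G H d d' (h : G -> H) rho rho' t :
  almost_isometry d' h -> (forall z, mdist (h (rho z)) (rho' z) <= d) ->
  mdist (h (teval rho t)) (teval rho' t) <= (tsize t)%:R * d.
Proof.
move=> [h1 hM _] rho_d.
have hV a : h a^-1%g = (h a)^-1%g.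
  by apply: (mulIg (h a)); rewrite -hM !mulVg.
elim: t => [x||s IHs t IHt|t IHt] /=.
- by rewrite mul1r.
- by rewrite h1 mdistxx mul0r.
- by rewrite hM natrD mulrDl (le_trans (mdist_mul _ _ _ _)) // lerD.
- by rewrite hV mdist_inv.
Qed.

(** The point is that [d] depends on [f] and [e] alone and serves all groups at once; it comes from
    the Lipschitz bound on terms and the uniform continuity of connectives. *)
Lemma qf_feval_almost_isometry (f : formula R) : quantifier_free f ->
  forall e : R, 0 < e -> exists2 d : R, 0 < d & forall G H (h : G -> H) rho rho',
    almost_isometry d h -> (forall z, mdist (h (rho z)) (rho' z) <= d) ->
    `|feval f rho - feval f rho'| <= e.
Proof.
elim: f => [s t|k u fs IH|//|//] /= qf e e0.
  (* The two sizes pay for moving the two terms, the extra 1 for the distortion of the metric by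
     [h]. *)
  pose c : R := (tsize s + tsize t).+1%:R; have c0 : 0 < c by rewrite ltr0n.
  exists (e / c) => [|G H h rho rho' hh hrho]; first by rewrite divr_gt0.
  have hs := teval_almost_isometry s hh hrho.
  have ht := teval_almost_isometry t hh hrho.
  have [_ _ /(_ (teval rho s) (teval rho t)) hst] := hh.
  have := metric_triangle (h (teval rho s)) (teval rho' s) (h (teval rho t)).
  have := metric_triangle (teval rho' s) (teval rho' t) (h (teval rho t)).
  have := metric_triangle (teval rho' s) (h (teval rho s)) (teval rho' t).
  have := metric_triangle (h (teval rho s)) (h (teval rho t)) (teval rho' t).
  rewrite (metric_sym (teval rho' s) (h _)) (metric_sym (teval rho' t) (h _)).
  have -> : e = (tsize s)%:R * (e / c) + (tsize t)%:R * (e / c) + e / c.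
    by rewrite -mulrDl -natrD -[X in _ + X]mul1r -mulrDl natr1 mulrC divfK ?gt_eqF.
  move: hs ht hst; set a := _ * _; set b := _ * _; move: a b (e / c) => a b q.
  rewrite !ler_norml => hs ht /andP[? ?] *; apply/andP; split; lra.
have [d d0 ud] := connective_unif_continuous u e0.
have [D D0 fsD] : exists2 D, 0 < D & forall i G H (h : G -> H) rho rho',
    almost_isometry D h -> (forall z, mdist (h (rho z)) (rho' z) <= D) ->
    `|feval (fs i) rho - feval (fs i) rho'| <= d.
  have /choice[D HD] : forall i, exists D, 0 < D /\ forall G H (h : G -> H) rho rho',
      almost_isometry D h -> (forall z, mdist (h (rho z)) (rho' z) <= D) ->
      `|feval (fs i) rho - feval (fs i) rho'| <= d.
    by move=> i; have [D] := IH i (qf i) d d0; exists D.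
  (* The default 1 keeps the minimum positive for a connective without arguments. *)
  exists (\big[Order.min/1]_i D i).
    by elim/big_ind: _ => // [a b a0 b0|i _]; [rewrite lt_min a0|case: (HD i)].
  move=> i G H h rho rho' [h1 hM hd] hrho.
  have le_i := bigmin_le_cond 1 D (erefl : xpredT i).
  apply: (HD i).2 => [|z]; last exact: le_trans (hrho z) le_i.
  by split=> // a b; exact: le_trans (hd a b) le_i.
exists D => // G H h rho rho' hh hrho; apply: ud.
- by move=> i; rewrite mxE feval_itv.
- by move=> i; rewrite mxE feval_itv.
- by move=> i; rewrite !mxE; apply: fsD hh hrho.
Qed.

(** Only one inequality survives quantification, since the image of [h] is just a part of the range
    of the supremum in [H]. The error does not grow with the length of [y]. *)
Lemma feval_sups_almost_isometry (f : formula R) : quantifier_free f ->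
  forall e : R, 0 < e -> exists2 d : R, 0 < d &
    forall (y : seq nat) G H (h : G -> H) rho rho',
    almost_isometry d h -> (forall z, mdist (h (rho z)) (rho' z) <= d) ->
    feval (foldr (@Sup R) f y) rho <= feval (foldr (@Sup R) f y) rho' + e.
Proof.
move=> qf e e0; have [d d0 fd] := qf_feval_almost_isometry qf e0; exists d => //.
move=> y G H h rho rho' hh.
elim: y rho rho' => [|x y IH] rho rho' hrho /=.
  by have := fd _ _ _ _ _ hh hrho; rewrite ler_norml => /andP[_]; rewrite lerBlDl addrC.
apply: ge_sup; first by exists (feval (foldr (@Sup R) f y) (upd rho x 1%g)); exists 1%g.
(* Answering [a] by [h a] creates no new discrepancy between the valuations. *)
move=> _ [a _ <-]; apply: le_trans (IH _ (upd rho' x (h a)) _) _.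
  by move=> z; rewrite /upd; case: eqP => // _; rewrite mdistxx ltW.
rewrite lerD2r; apply: ub_le_sup; last by exists (h a).
by exists 1 => _ [b _ <-]; case/andP: (feval_itv (foldr (@Sup R) f y) (upd rho' x b)).
Qed.

End ApproximateEmbeddings.

(** * A convergence criterion *)

(** The limit is the supremum of the eventual lower bounds of [v], that is, its limit inferior. *)
Lemma cvgn_almost_nonincreasing (R : realType) (v : nat -> R) :
  (forall n, 0 <= v n <= 1) ->
  (forall e : R, 0 < e -> exists n0, forall n, (n0 <= n)%N ->
    exists m0, forall m, (m0 <= m)%N -> v n <= v m + e) ->
  cvgn v.
Proof.
move=> v01 vS; pose A := [set a | exists n0, forall n, (n0 <= n)%N -> a <= v n].
have supA : has_sup A.
  split; first by exists 0, 0 => n _; case/andP: (v01 n).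
  by exists 1 => a [n0 /(_ _ (leqnn n0)) /le_trans]; apply; case/andP: (v01 n0).
apply/cvg_ex; exists (sup A); apply/cvgrPdist_le => e e0.
have [a [n1 an1] ae] := sup_adherent e0 supA.
have [n0 vn0] := vS e e0.
exists (maxn n0 n1) => // n /=; rewrite geq_max => /andP[n0n n1n].
have van := an1 _ n1n.
(* By hypothesis [v n - e] is itself an eventual lower bound. *)
have : v n - e <= sup A.
  apply: ub_le_sup; first by case: supA.
  have [m0 vm0] := vn0 n n0n; exists m0 => m /vm0; lra.
rewrite ler_norml => ?; apply/andP; split; lra.
Qed.

(** * Sorting and reindexing *)

Lemma sorting_perm m (f : 'I_m -> nat) :
  exists s : {perm 'I_m}, forall i j : 'I_m, (i <= j)%N -> (f (s i) <= f (s j))%N.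
Proof.
pose r := relpre f leq.
have /tuple_permP[s ts] : perm_eq (sort r (ord_tuple m)) (ord_tuple m).
  by rewrite perm_sort.
exists s => i j ij; have nths (k : 'I_m) : nth i (sort r (ord_tuple m)) k = s k.
  by rewrite ts -tnth_nth tnth_mktuple tnth_ord_tuple.
have szs : size (sort r (ord_tuple m)) = m by rewrite size_sort size_tuple.
rewrite -(nths i) -(nths j).
have r_trans : transitive r by move=> a b c; exact: leq_trans.
apply: (sorted_leq_nth r_trans) => //=; rewrite ?inE ?szs ?ltn_ord //.
  by move=> a; exact: leqnn.
by apply: sort_sorted => a b; exact: leq_total.
Qed.

Lemma big_mxtens (V : nmodType) n k (F : 'I_(n * k) -> V) :
  \sum_p F p = \sum_i \sum_l F (mxtens_index (i, l)).
Proof.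
rewrite pair_bigA /=; apply: reindex.
exists (@mxtens_unindex n k) => p _; first by case: p => i l; exact: mxtens_indexK.
by rewrite -[RHS]mxtens_unindexK.
Qed.

(** * Norms and sorted diagonalization of unitary matrices *)

Section Unitary.
Variable R : realType.
Local Notation C := R[i].
Local Notation normc := (@Normc.normc R).

Lemma sqr_normcE (z : C) : normc z ^+ 2 = complex.Re z ^+ 2 + complex.Im z ^+ 2.
Proof. by case: z => a b /=; rewrite sqr_sqrtr // addr_ge0 ?sqr_ge0. Qed.

Lemma sqr_normc_conj (z : C) : (normc z ^+ 2)%:C%C = z * z^*.
Proof. by rewrite -normCK rmorphXn. Qed.

(** Parallelogram law: the squared norms of [z - w] and [z + w] add up to 4. *)
Lemma sqr_normc_sub_le4 (z w : C) :
  normc z ^+ 2 = 1 -> normc w ^+ 2 = 1 -> normc (z - w) ^+ 2 <= 4.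
Proof.
rewrite !sqr_normcE; case: z w => [a b] [c d] /= ab cd.
have := sqr_ge0 (a + c); have := sqr_ge0 (b + d).
rewrite !sqrrD !sqrrN; lra.
Qed.

Lemma sqr_hsnorm n (A : 'M[C]_n) :
  hsnorm A ^+ 2 = \sum_i \sum_j normc (A i j) ^+ 2.
Proof.
by rewrite sqr_sqrtr //; do 2 apply: sumr_ge0 => ? _; exact: sqr_ge0.
Qed.

Lemma sqr_hsnorm_diag n (v : 'rV[C]_n) :
  hsnorm (diag_mx v) ^+ 2 = \sum_i normc (v 0 i) ^+ 2.
Proof.
rewrite sqr_hsnorm; apply: eq_bigr => i _; rewrite (bigD1 i) //= big1 ?addr0.
  by rewrite mxE eqxx.
by move=> j ji; rewrite mxE eq_sym (negPf ji) Normc.normc0 expr0n.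
Qed.

Lemma sqr_mdist n (A B : unitary R n) :
  mdist A B ^+ 2 = hsnorm (unitary_mx A - unitary_mx B) ^+ 2 / (4 * n%:R) :> R.
Proof.
have sqrt_sqr : Num.sqrt n%:R ^+ 2 = n%:R :> R by rewrite sqr_sqrtr ?ler0n.
rewrite /mdist /= /unitary_dist expr_div_n exprMn sqrt_sqr.
by have -> : 2 ^+ 2 = 4 :> R by ring.
Qed.

Lemma diag_unitarymx n (v : 'rV[C]_n) :
  (forall i, normc (v 0 i) ^+ 2 = 1) <-> diag_mx v \is unitarymx.
Proof.
have E : diag_mx v *m (diag_mx v)^t* = diag_mx (\row_i (v 0 i * (v 0 i)^*)).
  rewrite tr_diag_mx map_diag_mx mulmx_diag; congr diag_mx.
  by apply/rowP => i; rewrite !mxE.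
split=> [v1|/unitarymxP]; last first.
  rewrite E => /matrixP v1 i; have := v1 i i; rewrite !mxE eqxx -sqr_normc_conj.
  by move=> -[].
apply/unitarymxP; rewrite E; apply/matrixP => i j; rewrite !mxE -sqr_normc_conj v1.
by [].
Qed.

Definition diag_unitary n (v : 'rV[C]_n) (v1 : forall i, normc (v 0 i) ^+ 2 = 1) :
  unitary R n := Unitary ((diag_unitarymx v).1 v1).

Lemma perm_unitarymx n (s : {perm 'I_n}) : (perm_mx s : 'M[C]_n) \is unitarymx.
Proof.
by apply/unitarymxP; rewrite tr_perm_mx map_perm_mx -perm_mxM mulgV perm_mx1.
Qed.

Definition perm_unitary n (s : {perm 'I_n}) : unitary R n :=
  Unitary (perm_unitarymx s).

(** Spectral theorem for normal matrices. The eigenvalues have modulus 1 because the diagonal matrix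
    is a product of unitary ones. *)
Lemma unitary_diagonalization n (X : unitary R n) :
  exists (P : unitary R n) (v : 'rV[C]_n) (v1 : forall i, normc (v 0 i) ^+ 2 = 1),
    X = (P^-1 * diag_unitary v1 * P)%g.
Proof.
have Xn : unitary_mx X \is normalmx.
  apply/normalmxP; have /unitarymxP XX := unitary_mxP X.
  by rewrite XX (mulmx1C XX).
have /orthomx_spectral_subproof[[Q v] /= Qu XE] := Xn.
pose P := Unitary Qu; exists P, v.
have DE : diag_mx v = unitary_mx (P * X * P^-1)%g.
  rewrite /= XE invmx_unitary // !mulmxA; have /unitarymxP QQ := Qu.
  by rewrite QQ mul1mx -mulmxA QQ mulmx1.
have v1 : forall i, normc (v 0 i) ^+ 2 = 1.
  by apply/diag_unitarymx; rewrite DE; exact: unitary_mxP.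
exists v1; have -> : diag_unitary v1 = (P * X * P^-1)%g by apply: val_inj.
by rewrite !mulgA mulVg mul1g mulgVK.
Qed.

(** Conjugation by a permutation matrix permutes diagonal entries, so the sorting is absorbed into
    [P]. *)
Lemma unitary_sorted_diagonalization (key : C -> nat) n (X : unitary R n) :
  exists (P : unitary R n) (v : 'rV[C]_n) (v1 : forall i, normc (v 0 i) ^+ 2 = 1),
    X = (P^-1 * diag_unitary v1 * P)%g /\
    forall i j : 'I_n, (i <= j)%N -> (key (v 0%R i) <= key (v 0%R j))%N.
Proof.
have [P [v [v1 XE]]] := unitary_diagonalization X.
have [s s_sorted] := sorting_perm (fun i => key (v 0 i)).
have w1 i : normc ((\row_j v 0 (s j)) 0 i) ^+ 2 = 1 by rewrite mxE.
exists (perm_unitary s * P)%g, (\row_j v 0 (s j)), w1; split; last first.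
  by move=> i j ij; rewrite !mxE s_sorted.
have -> : diag_unitary w1 = (perm_unitary s * diag_unitary v1 * (perm_unitary s)^-1)%g.
  apply: val_inj; rewrite /= tr_perm_mx map_perm_mx -row_permE -col_permE.
  by apply/matrixP => i j; rewrite !mxE (inj_eq perm_inj).
by rewrite XE invgM !mulgA mulgVK -[LHS]mul1g !mulgA mulgVK mul1g.
Qed.

(** * Amplification of unitary matrices *)

Section Amplification.
Variables n k r : nat.

(** With the identity as right tensor factor, each entry of a diagonal [A] is repeated [k] times
    consecutively, which matches the blocks of a sorted list. *)
Definition amplify_mx (A : 'M[C]_n) : 'M[C]_(n * k + r) :=
  block_mx (A *t (1%:M : 'M[C]_k)) 0 0 1%:M.

Lemma amplify_mxM A B : amplify_mx (A *m B) = amplify_mx A *m amplify_mx B.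
Proof.
rewrite /amplify_mx mulmx_block !mulmx0 !mul0mx !addr0 add0r mulmx1.
by rewrite tensmx_mul mulmx1.
Qed.

Lemma tensmx1 (K : pzRingType) : (1%:M : 'M[K]_n) *t (1%:M : 'M[K]_k) = 1%:M.
Proof.
apply/matrixP => p q; case: (mxtens_indexP p) => i l; case: (mxtens_indexP q) => j l'.
rewrite tensmxE !mxE (inj_eq (can_inj (@mxtens_indexK n k))) xpair_eqE.
by case: eqP; case: eqP; rewrite ?mulr0 ?mul0r ?mulr1.
Qed.

Lemma amplify_mx1 : amplify_mx 1%:M = 1%:M.
Proof. by rewrite /amplify_mx tensmx1 -scalar_mx_block. Qed.

Lemma amplify_mx_adj A : amplify_mx (A ^t*) = (amplify_mx A) ^t*.
Proof.
rewrite /amplify_mx tr_block_mx map_block_mx trmx_tens map_mxT !trmx1 !map_mx1.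
by rewrite !trmx0 !map_mx0.
Qed.

Lemma amplify_unitarymx (A : unitary R n) : amplify_mx A \is unitarymx.
Proof.
apply/unitarymxP; rewrite -amplify_mx_adj -amplify_mxM.
by have /unitarymxP -> := unitary_mxP A; exact: amplify_mx1.
Qed.

Definition amplify (A : unitary R n) : unitary R (n * k + r) :=
  Unitary (amplify_unitarymx A).

Lemma amplifyM A B : amplify (A * B)%g = (amplify A * amplify B)%g.
Proof. by apply: val_inj; exact: amplify_mxM. Qed.

Lemma amplify1 : amplify 1%g = 1%g.
Proof. by apply: val_inj; exact: amplify_mx1. Qed.

(** The identity corners cancel, and each entry of [A - B] occurs once in each of the [k] copies. *)
Lemma sqr_hsnorm_amplify A B :
  hsnorm (amplify_mx A - amplify_mx B) ^+ 2 = k%:R * hsnorm (A - B) ^+ 2.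
Proof.
rewrite /amplify_mx opp_block_mx add_block_mx !subrr !sqr_hsnorm big_split_ord /=.
rewrite [X in _ + X]big1 ?addr0; last first.
  move=> i _; rewrite big1 // => j _; rewrite /block_mx col_mxEd.
  by rewrite row_mx0 mxE Normc.normc0 expr0n.
rewrite big_mxtens mulr_sumr; apply: eq_bigr => i _.
rewrite mulr_natl -[in RHS](card_ord k) -sumr_const; apply: eq_bigr => l _.
rewrite big_split_ord /= [X in _ + X]big1 ?addr0; last first.
  by move=> j _; rewrite block_mxEur mxE Normc.normc0 expr0n.
rewrite big_mxtens; apply: eq_bigr => j _; rewrite (bigD1 l) //= big1 ?addr0.
  by rewrite block_mxEul !mxE !mxtens_indexK /= eqxx !mulr1.
move=> l' l'l; rewrite block_mxEul !mxE !mxtens_indexK /= eq_sym (negPf l'l).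
by rewrite !mulr0 subrr Normc.normc0 expr0n.
Qed.

End Amplification.
End Unitary.

(** * Boxes on the circle and block approximation *)

Section Circle.
Variable R : realType.
Local Notation C := R[i].
Local Notation normc := (@Normc.normc R).

(** A square grid of mesh [1 / K]: points of one box differ by at most [1 / K] in each coordinate.
    The key writes the two grid indices as digits in base [N]. *)
Lemma circle_boxes (e : R) : 0 < e -> exists (M : nat) (key : C -> nat),
  (forall z, normc z ^+ 2 = 1 -> (key z < M)%N) /\
  (forall z w, normc z ^+ 2 = 1 -> normc w ^+ 2 = 1 -> key z = key w ->
    normc (z - w) ^+ 2 <= e).
Proof.
(* [K] exceeds [2 / e], so the squared distance [2 / K ^ 2] is at most [e]. The indices run from 0
   to [2 * K], the last one being reached at coordinate 1. *)
move=> e0; pose K := (Num.bound (2 / e)).+1; pose N := (2 * K).+1.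
pose t (x : R) := Num.trunc ((x + 1) * K%:R).
have K0 : 0 < K%:R :> R by rewrite ltr0n.
have Ke : 2 <= e * K%:R.
  rewrite mulrC -ler_pdivrMr // (le_trans (ltW (archi_boundP _))) ?divr_ge0 ?ltW //.
  by rewrite ltr_nat.
have tP x : -1 <= x <= 1 ->
    (t x < N)%N /\ (t x)%:R <= (x + 1) * K%:R < (t x)%:R + 1.
  move=> /andP[x_ge x_le]; have : 0 <= (x + 1) * K%:R by rewrite mulr_ge0 //; lra.
  move=> /truncn_itv; rewrite -/(t x) -natr1 => /[dup] tx /andP[tx1 _]; split=> //.
  by rewrite ltnS -(ler_nat R) (le_trans tx1) // natrM ler_wpM2r //; lra.
have coord_itv (a b : R) : a ^+ 2 + b ^+ 2 = 1 -> (-1 <= a <= 1) * (-1 <= b <= 1).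
  by move=> ab; split; apply/andP; split; nra.
have same_box (x y : R) : -1 <= x <= 1 -> -1 <= y <= 1 -> t x = t y ->
    (x * K%:R - y * K%:R) ^+ 2 <= 1.
  move=> /tP[_ /andP[x1 x2]] /tP[_ /andP[y1 y2]] txy; rewrite txy in x1 x2.
  rewrite !mulrDl !mul1r in x1 x2 y1 y2.
  rewrite -real_normK ?num_real // expr_le1 // ler_norml; apply/andP; split; lra.
exists (N * N)%N, (fun z => t (complex.Re z) * N + t (complex.Im z))%N; split.
  move=> [a b]; rewrite sqr_normcE /= => /coord_itv[/tP[ta _] /tP[tb _]]; nia.
move=> [a b] [c d]; rewrite !sqr_normcE /= => /coord_itv[a1 b1] /coord_itv[c1 d1].
move=> tE; have [ta _] := tP _ a1; have [tb _] := tP _ b1.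
have [tc _] := tP _ c1; have [td _] := tP _ d1.
have tac : t a = t c by nia.
have tbd : t b = t d by nia.
have := lerD (same_box _ _ a1 c1 tac) (same_box _ _ b1 d1 tbd).
have K1 : 1 <= K%:R :> R by rewrite ler1n.
have Ke2 : 1 + 1 <= K%:R * K%:R * e by nra.
move=> /le_trans/(_ Ke2) ac_bd; rewrite -(ler_pM2l (mulr_gt0 K0 K0)).
by apply: le_trans ac_bd; rewrite le_eqVlt; apply/orP; left; apply/eqP; ring.
Qed.

Section BlockApproximation.
Variables (n k r M : nat) (key : C -> nat) (e : R).
Variable v : 'rV[C]_(n * k.+1 + r).
Hypothesis e0 : 0 <= e.
Hypothesis key_lt : forall z, normc z ^+ 2 = 1 -> (key z < M)%N.
Hypothesis key_eq : forall z w, normc z ^+ 2 = 1 -> normc w ^+ 2 = 1 ->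
  key z = key w -> normc (z - w) ^+ 2 <= e.
Hypothesis v1 : forall i, normc (v 0 i) ^+ 2 = 1.
Hypothesis v_sorted : forall i j : 'I_(n * k.+1 + r), (i <= j)%N ->
  (key (v 0%R i) <= key (v 0%R j))%N.

Definition block_heads : 'rV[C]_n :=
  \row_j v 0 (lshift r (mxtens_index (j, ord0))).

Lemma amplify_diag_mx (w : 'rV[C]_n) :
  amplify_mx k.+1 r (diag_mx w) =
  diag_mx (row_mx (\row_p w 0 (mxtens_unindex p).1) (const_mx 1)).
Proof.
rewrite diag_mx_row diag_const_mx /amplify_mx; congr block_mx.
apply/matrixP => p q; rewrite !mxE.
case: (mxtens_indexP p) => i l; case: (mxtens_indexP q) => j l'.
rewrite (inj_eq (can_inj (@mxtens_indexK n k.+1))) xpair_eqE !mxtens_indexK /=.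
by case: eqP; case: eqP; rewrite ?mulr0 ?mul0r ?mulr1.
Qed.

(* An entry with the same key as the head of its block is [e]-close to it; any
   other entry costs at most 4, which is charged to the increase of the key over
   the block. These increases telescope. *)
Lemma block_heads_close :
  hsnorm (amplify_mx k.+1 r (diag_mx block_heads) - diag_mx v) ^+ 2 <=
    (n * k.+1)%:R * e + 4 * k.+1%:R * M%:R + 4 * r%:R.
Proof.
rewrite amplify_diag_mx -linearB sqr_hsnorm_diag big_split_ord /=; apply: lerD.
  (* The default [M] extends the keys past the end, still monotone and bounded by [M]; when [r = 0]
     the last block has no successor entry and needs it. *)
  pose b i := (if insub i is Some p then key (v 0%R p) else M)%N.
  have bE (p : 'I_(n * k.+1 + r)) : b p = key (v 0 p).
    by rewrite /b insubT //= => ?; congr (key (v _ _)); apply: val_inj.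
  have b_le i : (b i <= M)%N.
    by rewrite /b; case: insubP => // p _ _; exact/ltnW/key_lt.
  have b_mono i j : (i <= j)%N -> (b i <= b j)%N.
    move=> ij; rewrite {2}/b; case: insubP => [q _ qj|_]; last exact: b_le.
    have ilt : (i < n * k.+1 + r)%N by rewrite (leq_ltn_trans ij) // -qj ltn_ord.
    by rewrite (bE (Ordinal ilt)); apply: v_sorted; rewrite /= qj.
  pose B j : R := (b (j * k.+1)%N)%:R.
  rewrite big_mxtens.
  apply: (@le_trans _ _ (\sum_(j < n) \sum_(l < k.+1) (e + 4 * (B j.+1 - B j)))).
    apply: ler_sum => j _; apply: ler_sum => l _.
    rewrite mxE row_mxEl !mxE (congr1 fst (mxtens_indexK (j, l)) : Ordinal _ = j).
    set p := lshift _ _; set q := lshift _ _.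
    have Bp : B j = (key (v 0 p))%:R by rewrite /B -bE /= addn0.
    have pq : (key (v 0%R p) <= key (v 0%R q))%N by apply: v_sorted => /=; lia.
    have Bq : (key (v 0 q))%:R <= B j.+1.
      rewrite ler_nat -bE; apply: b_mono => /=; have := ltn_ord l; lia.
    have [pqE|pqN] := eqVneq (key (v 0 p)) (key (v 0 q)).
      have := key_eq (v1 p) (v1 q) pqE; move: Bq; rewrite -pqE Bp; lra.
    (* Keys are integers, so a strict increase is at least 1 and [4 * (B j.+1 - B j)] covers the
       cost. *)
    have {pqN} : (key (v 0%R p) < key (v 0%R q))%N by rewrite ltn_neqAle pqN.
    rewrite -(ler_nat R) -(natr1 (key _)) => /le_trans/(_ Bq); rewrite -Bp => BB.
    apply: le_trans (sqr_normc_sub_le4 (v1 p) (v1 q)) _.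
    by rewrite -[X in X <= _]add0r lerD // ler_peMr // lerBrDl.
  rewrite (eq_bigr (fun j : 'I_n => k.+1%:R * (e + 4 * (B j.+1 - B j)))); last first.
    by move=> j _; rewrite sumr_const card_ord [RHS]mulr_natl.
  rewrite -mulr_sumr big_split /= sumr_const card_ord -[e *+ n]mulr_natl -mulr_sumr.
  rewrite -(big_mkord xpredT (fun j => B j.+1 - B j)) telescope_sumr //.
  have : B n - B 0%N <= M%:R.
    have := b_le (n * k.+1)%N; rewrite /B -(ler_nat R).
    by have := ler0n R (b (0 * k.+1)%N); lra.
  rewrite natrM => Bn; have k0 : 0 <= k.+1%:R :> R by [].
  nra.
rewrite mulr_natr -[in X in _ *+ X](card_ord r) -sumr_const.
apply: ler_sum => i _; rewrite mxE row_mxEr !mxE.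
by apply: sqr_normc_sub_le4 => //; rewrite Normc.normc1 expr1n.
Qed.

End BlockApproximation.
End Circle.

(** * Approximation by amplified matrices *)

Section Approximation.
Variable R : realType.

(** With [m = n * k + r], distances are multiplied by the square root of [n * k / m]. This factor
    lies between [n * k / m] and 1, so the loss is at most [r / m]. *)
Lemma conj_amplify_almost_isometry n k r (Q : unitary R (n * k + r)) (d : R) :
  (0 < n)%N -> (0 < k)%N -> r%:R <= d * (n * k + r)%:R ->
  almost_isometry d (fun A : unitary R n => Q^-1 * amplify k r A * Q)%g.
Proof.
move=> n0 k0 rd; have m0 : 0 < (n * k + r)%:R :> R by rewrite ltr0n; lia.
split=> [|a b|a b].
- by rewrite amplify1 mulg1 mulVg.
- by rewrite amplifyM !mulgA mulgK.
rewrite mdist_mulr mdist_mull; set h : R := mdist (amplify k r a) _.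
have h0 : 0 <= h := mdist_ge0 _ _.
have b0 : 0 <= mdist a b := mdist_ge0 a b.
have b1 : mdist a b <= 1 := mdist_le1 a b.
have nR0 : 0 < n%:R :> R by rewrite ltr0n.
have hE : h ^+ 2 * (n * k + r)%:R = (n * k)%:R * mdist a b ^+ 2.
  rewrite /h !sqr_mdist sqr_hsnorm_amplify natrM.
  by move: (n * k + r)%:R m0 => m m0; field; rewrite !gt_eqF.
move: h (mdist a b) h0 b0 b1 hE => h t h0 t0 t1 hE.
have ht : h <= t.
  rewrite -(ler_pXn2r (n := 2)) ?nnegrE // -(ler_pM2r m0) hE mulrC ler_wpM2l ?sqr_ge0 //.
  by rewrite ler_nat leq_addr.
have th : (n * k)%:R * t <= h * (n * k + r)%:R.
  rewrite -(ler_pXn2r (n := 2)) ?nnegrE ?mulr_ge0 // !exprMn.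
  rewrite [X in _ <= _ * X]expr2 [X in _ <= X]mulrA hE expr2 -!mulrA ler_wpM2l //.
  by rewrite [X in _ <= X]mulrA -expr2 mulrC ler_wpM2l ?sqr_ge0 // ler_nat leq_addr.
rewrite distrC ger0_norm ?subr_ge0 // -(ler_pM2r m0); apply: le_trans rd.
rewrite mulrBl; move: th; rewrite natrD mulrDr.
have : t * r%:R <= r%:R by rewrite ler_piMl.
rewrite [(n * k)%:R * _]mulrC; lra.
Qed.

(** With boxes of squared diameter at most [d ^ 2], each of the three terms of the block estimate is
    at most [d ^ 2 * m], within the allowance [4 * m * d ^ 2] of the normalized metric. *)
Lemma unitary_amplify_approx (d : R) : 0 < d ->
  exists n0, forall n, (n0 <= n)%N -> exists m0, forall m, (m0 <= m)%N ->
  forall X : unitary R m, exists (h : unitary R n -> unitary R m) (A : unitary R n),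
    almost_isometry d h /\ mdist (h A) X <= d.
Proof.
move=> d0; have d20 : 0 < d ^+ 2 by rewrite exprn_gt0.
have [M [key [key_lt key_eq]]] := circle_boxes d20.
have div_nat_le (a b : R) : 0 <= a -> 0 < b -> exists n0, forall n, (n0 <= n)%N ->
    a <= b * n%:R.
  move=> a0 b0; exists (Num.bound (a / b)) => n nn; rewrite mulrC -ler_pdivrMr //.
  apply: le_trans (ltW (archi_boundP _)) _; last by rewrite ler_nat.
  by rewrite divr_ge0 // ltW.
have [n0 Hn0] := div_nat_le (4 * M%:R) _ (mulr_ge0 (ler0n R 4) (ler0n R M)) d20.
(* [M] depends on [d] only, so [n] can be taken large against it. The successor makes [n] positive
   for the division of [m] by [n]. *)
exists n0.+1 => n nn0; have {Hn0} nM := Hn0 n (ltnW nn0).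
(* [m1] controls the metric distortion [r / m], and [m2] the cost of the remainder entries. *)
have [m1 Hm1] := div_nat_le n%:R _ (ler0n R n) d0.
have [m2 Hm2] := div_nat_le (4 * n%:R) _ (mulr_ge0 (ler0n R 4) (ler0n R n)) d20.
exists (n + m1 + m2)%N => m mm.
have {Hm1} md : n%:R <= d * m%:R by apply: Hm1; lia.
have {Hm2} md2 : 4 * n%:R <= d ^+ 2 * m%:R by apply: Hm2; lia.
have n_gt0 : (0 < n)%N by lia.
have [k [r [mE rn]]] : exists k r, m = (n * k.+1 + r)%N /\ (r <= n)%N.
  exists (m %/ n).-1, (m %% n)%N; split; last by rewrite ltnW ?ltn_mod.
  by rewrite prednK ?divn_gt0 //; [rewrite mulnC -divn_eq|lia].
subst m => X.
have [P [v [v1 [XE v_sorted]]]] := unitary_sorted_diagonalization key X.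
have w1 i : Normc.normc (block_heads v 0 i) ^+ 2 = 1 by rewrite mxE.
have rnR : r%:R <= n%:R :> R by rewrite ler_nat.
exists (fun A => P^-1 * amplify k.+1 r A * P)%g, (diag_unitary w1); split.
  by apply: conj_amplify_almost_isometry => //; exact: le_trans md.
rewrite XE mdist_mulr mdist_mull -(ler_pXn2r (n := 2)) ?nnegrE ?mdist_ge0 ?(ltW d0) //.
have m0 : 0 < (n * k.+1 + r)%:R :> R by rewrite ltr0n; lia.
rewrite sqr_mdist ler_pdivrMr ?mulr_gt0 //.
apply: le_trans (block_heads_close (ltW d20) key_lt key_eq v1 v_sorted) _.
have kM := ler_wpM2r (ler0n R k.+1) nM.
have dr : 0 <= d ^+ 2 * r%:R by rewrite mulr_ge0 ?(ltW d20).
have dnk : 0 <= d ^+ 2 * n%:R * k.+1%:R by rewrite mulr_ge0 // mulr_ge0 // ltW.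
rewrite !natrD !natrM in md2 *.
move: (d ^+ 2) n%:R k.+1%:R r%:R M%:R md2 kM dr dnk rnR => D N K r' M' *.
lra.
Qed.

End Approximation.

Theorem theorem5p9 (R : realType) (n x : nat) (y : n.-tuple nat)
    (psi : formula R) :
  uniq (x :: y) ->
  quantifier_free psi ->
  (forall z : nat, free_in z psi -> z \in x :: y) ->
  cvgn (fun N : nat =>
    sentence_value (unitary R N) (Inf x (foldr (@Sup R) psi y))).
Proof.
move=> _ qf _; apply: cvgn_almost_nonincreasing => [N|e e0]; first exact: feval_itv.
have [d d0 psi_d] := feval_sups_almost_isometry qf e0.
have [n0 Hn0] := unitary_amplify_approx d0.
exists n0 => N /Hn0[m0 Hm0]; exists m0 => m /Hm0 approx.
rewrite -lerBlDr /sentence_value /=.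
apply: lb_le_inf; first by eexists; exists 1%g.
(* Each candidate [X] in rank [m] yields a candidate [A] for the outer infimum in rank [N], at least
   as good up to [e]. *)
move=> _ [X _ <-]; have [h [A [hiso hA]]] := approx X.
rewrite lerBlDr; apply: le_trans (psi_d y _ _ h (upd (fun=> 1%g) x A) _ hiso _).
  apply: ge_inf; last by exists A.
  exists 0 => _ [B _ <-].
  by case/andP: (feval_itv (foldr (@Sup R) psi y) (upd (fun=> 1%g) x B)).
(* Variables other than [x] are sent to the identity, which [h] fixes. *)
have [h1 _ _] := hiso.
by move=> z; rewrite /upd; case: eqP => // _; rewrite h1 mdistxx ltW.
Qed.
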